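(* Let $A$ be a finite set with $|A|\ge 2$, let $n\ge 2$, and let $\phi:[n]\to[n]$ have $F$ fixed points and $D$ detached cycles (of length at least $2$). Then the procedural complexity $\mathcal{L}(f^\phi)$ of the manipulation of variables $f^\phi:A^n\to A^n$ is exactly - $n-F+D$ if $\phi$ is a permutation of $[n]$; - $n-F+1$ if $\phi$ is not a permutation and $D>0$; - $n-F$ otherwise.
   Context: $[n]=\{1,\dots,n\}$; the image of $i$ under $\phi:[n]\to[n]$ is written $i\phi$, and $\phi^k$ is the $k$-th iterate. The manipulation of variables induced by $\phi$ is $f^\phi:A^n\to A^n$, $f^\phi(x_1,\dots,x_n)=(x_{1\phi},\dots,x_{n\phi})$. A cycle of $\phi$ is a cycle $(i,i\phi,\dots,i\phi^{k-1})$ with $i\phi^k=i$ (these elements distinct) of the directed graph on $[n]$ with arcs $(i,i\phi)$; it is detached if no element $j\in[n]$ outside the cycle is mapped by $\phi$ to an element of the cycle. Fixed points are not counted as detached cycles, so $D$ counts detached cycles of length $k\ge2$. A transformation of $A^n$ is a map $f=(f_1,\dots,f_n):A^n\to A^n$; its coordinate function $f_i:A^n\to A$ is trivial if $f_i(x)=x_i$ for all $x$. An instruction is a transformation of $A^n$ with at most one nontrivial coordinate function. A program of length $L$ computing $f$ is a sequence of instructions $g^1,\dots,g^L$ with $f=g^L\circ\cdots\circ g^1$. The procedural complexity $\mathcal{L}(f)$ is the shortest length of a program computing $f$; the identity has procedural complexity $0$. *)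

(* Defs.v *)
From mathcomp Require Import all_boot.

Set Implicit Arguments.
Unset Strict Implicit.
Unset Printing Implicit Defensive.

Section ProceduralComplexity.

Variables (A : finType) (n : nat).

Definition state := {ffun 'I_n -> A}.

Definition transformation := state -> state.

Definition trivial_coord (f : transformation) (i : 'I_n) : bool :=
  [forall x : state, f x i == x i].

Definition instruction (f : transformation) : bool :=
  #|[set i : 'I_n | ~~ trivial_coord f i]| <= 1.

(* The head of the list is executed first, so [:: g1; ...; gL] runs
   gL \o ... \o g1. *)
Definition run (p : seq transformation) : transformation :=
  fun x => foldl (fun y g => g y) x p.

Definition computes (p : seq transformation) (f : transformation) : Prop :=
  all instruction p /\ run p =1 f.

(* A relation rather than a function to nat, since a minimum exists only once
   some program computing f is known to exist; it determines L uniquely. *)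
Definition procedural_complexity_is (f : transformation) (L : nat) : Prop :=
  (exists2 p, computes p f & size p = L) /\
  (forall p, computes p f -> L <= size p).

Definition manipulation (phi : 'I_n -> 'I_n) : transformation :=
  fun x => [ffun i => x (phi i)].

End ProceduralComplexity.

Section Cycles.

Variables (n : nat) (phi : 'I_n -> 'I_n).

Definition fixed_points : {set 'I_n} := [set i | phi i == i].

(* A cycle (i, phi i, ..., phi^(k-1) i), considered up to rotation, is
   represented by its set of elements, which determines it.  Its elements are
   distinct, so k <= n and it suffices to let k range over 'I_n.+1. *)
Definition is_cycle (C : {set 'I_n}) : bool :=
  [exists i : 'I_n, exists k : 'I_n.+1,
     [&& 0 < k, iter k phi i == i, uniq (traject phi i k)
       & C == [set j in traject phi i k]]].

Definition detached (C : {set 'I_n}) : bool :=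
  [forall j : 'I_n, (j \notin C) ==> (phi j \notin C)].

Definition detached_cycles : {set {set 'I_n}} :=
  [set C | [&& is_cycle C, detached C & 2 <= #|C|]].

End Cycles.

(* Main.v *)
(* Lower bound: every non-fixed coordinate must be updated.  Let C be a detached
   cycle each of whose coordinates is updated only once, and consider the first
   update of C, which overwrites x_j by x_(phi j).  If phi is a permutation,
   every instruction of the program is a bijection, but this one forgets the
   content of j.  If every coordinate outside C is also updated at most once,
   the state after this update does not depend on x_j, which is needed later.

   Upper bound: with a copy to spare, values can be moved one instruction per
   coordinate, from the leaves of phi onwards; only detached cycles obstruct
   this.  A detached cycle is rotated with one extra instruction by first
   storing in one of its coordinates the sum of all of its values (A being
   identified with a cyclic group).  If phi has a leaf, that leaf can hold the
   sum over all detached cycles at once, so one extra instruction suffices. *)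

Require Import Defs.
From mathcomp Require Import all_boot ssralg zmodp.
Set Implicit Arguments.
Unset Strict Implicit.
Unset Printing Implicit Defensive.

(** * Lower bound: counting the updates of each coordinate *)

Section Updates.
Variables (A : finType) (n : nat).
Implicit Types (p : seq (transformation A n)) (g : transformation A n).
Implicit Types (x y : state A n) (i j : 'I_n).

Definition updates p i := count (fun g => ~~ trivial_coord g i) p.

Lemma trivial_coord_id g i x : trivial_coord g i -> g x i = x i.
Proof. by move/forallP/(_ x)/eqP. Qed.

Lemma instruction_id g i j x :
  instruction g -> ~~ trivial_coord g j -> i != j -> g x i = x i.
Proof.
move=> /card_le1_eqP inj ntj ij; apply: trivial_coord_id.
apply: contraNT ij => nti; apply/eqP; apply: inj; by rewrite inE.
Qed.

Lemma run_cat p q x : run (p ++ q) x = run q (run p x).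
Proof. by rewrite /run foldl_cat. Qed.

Lemma run_id p i x : updates p i = 0 -> run p x i = x i.
Proof.
elim: p x => [//|g p IH] x /eqP; rewrite /updates /= addn_eq0 eqb0 negbK.
by case/andP=> tg /eqP up; rewrite [run _ _]/(run p (g x)) IH // trivial_coord_id.
Qed.

Lemma sum_updates p : all (@instruction A n) p -> \sum_i updates p i <= size p.
Proof.
elim: p => [_|g p IH /= /andP[ig ip]]; first by rewrite big1.
rewrite /updates /= big_split /= -add1n leq_add ?IH //.
apply: leq_trans ig; rewrite -sum1_card [leqRHS]big_mkcond /=.
by apply: leq_sum => i _; rewrite inE; case: trivial_coord.
Qed.

Variable phi : 'I_n -> 'I_n.
Hypothesis hA : 2 <= #|A|.

Lemma states_differ_at i :
  exists x : state A n, exists2 y : state A n,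
    x i != y i & forall j, j != i -> x j = y j.
Proof.
have /card_gt1P[a [b [_ _ ab]]] := hA.
exists [ffun=> a], [ffun j => if j == i then b else a].
  by rewrite !ffunE eqxx.
by move=> j /negPf ji; rewrite !ffunE ji.
Qed.

Lemma updates_gt0 p i :
  computes p (manipulation phi) -> phi i != i -> 0 < updates p i.
Proof.
case=> _ pE ni; rewrite lt0n; apply/eqP => /run_id ri.
have [x [y xy eqxy]] := states_differ_at i.
have := pE x; have := pE y => /ffunP/(_ i) + /ffunP/(_ i).
rewrite !ri !ffunE => yi xi; case/negP: xy.
by rewrite xi yi eqxy.
Qed.

(** Each non-fixed coordinate accounts for one update, and a second update of any coordinate, fixed
    or not, for one more. The lower bounds thus reduce to finding coordinates updated twice. *)
Lemma size_program_ge p : computes p (manipulation phi) ->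
  n - #|fixed_points phi| + #|[set i | 1 < updates p i]| <= size p.
Proof.
move=> cp; apply: leq_trans (sum_updates cp.1).
have -> : n - #|fixed_points phi| = #|~: fixed_points phi|.
  by rewrite [RHS]cardsCs setCK card_ord.
rewrite -!sum1_card [X in X + _]big_mkcond [X in _ + X]big_mkcond -big_split /=.
apply: leq_sum => i _; rewrite !inE.
have := @updates_gt0 p i cp; case: eqP => /= _; first by case: updates => [|[]].
by case: updates => [/(_ isT)|[]].
Qed.

(** Common start of both lower bounds: [g] is the first instruction that touches [C]. As [j] is not
    updated again, [g] must already give it its final value. *)
Lemma first_update p (C : {set 'I_n}) i0 :
    computes p (manipulation phi) -> i0 \in C -> phi i0 != i0 ->
    {in C, forall i, updates p i <= 1} ->
  exists p1 g p2 j, [/\ p = p1 ++ g :: p2, j \in C,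
    {in C, forall i, updates p1 i = 0},
    forall x i, i != j -> g x i = x i
  & forall x, g (run p1 x) j = x (phi j)].
Proof.
move=> cp Ci0 ni0 up1.
pose touches g := [exists i in C, ~~ trivial_coord g i].
have hasp : has touches p.
  have := updates_gt0 cp ni0; rewrite -has_count; apply: sub_has => g ng.
  by apply/exists_inP; exists i0.
case: (split_find hasp) cp up1 => g p1 p2 /exists_inP[j Cj nj] np1.
rewrite cat_rcons => -[/[!all_cat]/= /and3P[_ ig _] pE] up1.
exists p1, g, p2, j; split=> //.
- move=> i Ci; apply/eqP; rewrite -leqn0 leqNgt -has_count.
  apply: contra np1; apply: sub_has => h nh; apply/exists_inP; by exists i.
- by move=> x i; apply: instruction_id.
move=> x; have := pE x => /ffunP/(_ j); rewrite run_cat ffunE => <-.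
rewrite [run (g :: _) _]/(run p2 _) run_id //; apply/eqP.
have := up1 j Cj; rewrite /updates count_cat /= nj addnA -leqn0.
by rewrite addn1 addSn ltnS => /(leq_trans (leq_addl _ _)).
Qed.

Lemma bijective_updates p (C : {set 'I_n}) i0 :
    bijective phi -> computes p (manipulation phi) ->
    i0 \in C -> {in C, forall i, phi i != i /\ phi i \in C} ->
  exists2 i, i \in C & 1 < updates p i.
Proof.
move=> bphi cp Ci0 hC; case: (boolP [exists i in C, 1 < updates p i]).
  by move/exists_inP.
rewrite negb_exists_in => /forall_inP up1.
have {}up1 : {in C, forall i, updates p i <= 1} by move=> i /up1; rewrite -leqNgt.
have [p1 [g [p2 [j [pE Cj p1C gE gj]]]]] :=
  first_update cp Ci0 (hC _ Ci0).1 up1.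
have runE x : manipulation phi x = run p2 (g (run p1 x)).
  by rewrite -cp.2 pE run_cat.
have inj_manip : injective (@manipulation A n phi).
  have [psi _ phiK] := bphi; move=> x y /ffunP xy; apply/ffunP => i.
  by have := xy (psi i); rewrite !ffunE phiK.
have inj1 : injective (run p1).
  by move=> x y xy; apply: inj_manip; rewrite !runE xy.
(* [run p1] is injective on a finite set, hence onto, so the formula for [g] on reached states holds
   on all states. *)
have [q _ qK] := injF_bij inj1.
have [s [t st eqst]] := states_differ_at j.
have [nj Cpj] := hC _ Cj.
have gst : g s = g t.
  apply/ffunP => i; have [->|ij] := eqVneq i j; last by rewrite !gE // eqst.
  have gjE z : g z j = z (phi j).
    by rewrite -{1}(qK z) gj -(run_id (q z) (p1C _ Cpj)) qK.
  by rewrite !gjE eqst.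
have /inj_manip qst : manipulation phi (q s) = manipulation phi (q t).
  by rewrite !runE !qK gst.
by case/negP: st; rewrite -(qK s) qst qK.
Qed.

Lemma detached_updates p (C : {set 'I_n}) i0 :
    computes p (manipulation phi) -> i0 \in C ->
    {in C, forall i, phi i != i /\ exists j, phi j = i} ->
    (forall i, (phi i \in C) = (i \in C)) ->
  exists i, 1 < updates p i.
Proof.
move=> cp Ci0 hC detC; apply/existsP; apply: contraT.
rewrite negb_exists => /forallP up1.
have {}up1 i : updates p i <= 1 by rewrite leqNgt.
have [p1 [g [p2 [j [pE Cj p1C gE gj]]]]] :=
  first_update cp Ci0 (hC _ Ci0).1 (fun i _ => up1 i).
have runE x : manipulation phi x = run p2 (g (run p1 x)).
  by rewrite -cp.2 pE run_cat.
have [x [y xy eqxy]] := states_differ_at j.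
have [nj [k kj]] := hC _ Cj.
(* A coordinate outside [C] updated in [p1] is changed neither by [g] nor by [p2], so it holds its
   final value; detachedness makes that value independent of [x j]. *)
have run1 z i : i \notin C -> updates p1 i != 0 -> run p1 z i = z (phi i).
  move=> nCi ui; have ij : i != j by apply: contraNneq nCi => ->.
  have := runE z => /ffunP/(_ i); rewrite ffunE => ->.
  rewrite (@run_id p2) ?gE //; apply/eqP; rewrite -leqn0.
  have := up1 i; rewrite pE /updates count_cat /= -/(updates p1 i).
  case: (updates p1 i) ui => // u _; rewrite addSn ltnS addnA.
  by apply: leq_trans (leq_addl _ _).
have gxy : g (run p1 x) = g (run p1 y).
  apply/ffunP => i; have [->|ij] := eqVneq i j; first by rewrite !gj eqxy.
  rewrite !gE //; have [ui|ui] := eqVneq (updates p1 i) 0.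
    by rewrite !run_id ?eqxy.
  have nCi : i \notin C by apply: contra ui => /p1C ->.
  rewrite !run1 // eqxy //; apply: contraNneq nCi => pij.
  by rewrite -detC pij.
have : manipulation phi x k = manipulation phi y k by rewrite !runE gxy.
by rewrite !ffunE kj => /eqP; rewrite (negPf xy).
Qed.
End Updates.

(** * Detached cycles as orbits of [phi] *)

Section DetachedCycles.
Variables (n : nat) (phi : 'I_n -> 'I_n).
Implicit Types (C U : {set 'I_n}) (i j : 'I_n).

Lemma detached_cyclesP C : C \in detached_cycles phi ->
  [/\ C != set0, {in C, forall i, phi i != i},
      forall i, (phi i \in C) = (i \in C),
      {in C &, injective phi}
    & {in C, forall i, C = [set j in orbit phi i]}].
Proof.
rewrite inE => /and3P[/existsP[i0 /existsP[k /and4P[k0 /eqP ki0 uC /eqP CE]]]].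
move=> /forallP detC C2; set s := traject phi i0 k in uC CE.
have cyc : fcycle phi s.
  rewrite /s; case: (k : nat) k0 ki0 => // m _ mi0.
  by apply/fpathP; exists m.+1; rewrite trajectSr -iterSr mi0.
have sC i : (i \in s) = (i \in C) by rewrite CE inE.
have orbC i : i \in C -> C = [set j in orbit phi i].
  rewrite -sC => si; apply/setP => j; rewrite inE -sC.
  by rewrite (orbitE cyc uC si) mem_rot.
have cycC i : i \in C -> fcycle phi (orbit phi i).
  by rewrite -sC => si; exact: (cycle_orbit_cycle cyc).
have closedC i : i \in C -> phi i \in C.
  by move=> Ci; rewrite (orbC i Ci) inE -fconnect_orbit fconnect1.
split=> //.
- by rewrite -card_gt0 ltnW.
- move=> i Ci; apply/eqP => fi; suff: #|C| <= 1 by rewrite leqNgt C2.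
  rewrite (orbC i Ci) cardsE; apply/card_le1_eqP => j k'.
  have it m : iter m phi i = i by elim: m => //= m ->.
  by rewrite -!fconnect_orbit => /iter_findex <- /iter_findex <-; rewrite !it.
- move=> i; apply/idP/idP => [|/closedC//]; apply: contraLR => nCi.
  by have /implyP/(_ nCi) := detC i.
(* In the list of equivalent statements [orbitPcycle], 0 says that the orbit is a cycle and 5 that
   the map is injective on it. *)
move=> i j Ci Cj; have /cycC/(orbitPcycle 0 5) inj := Ci.
by move: (Ci) Cj; rewrite {1 2}(orbC i Ci) !inE; apply: inj.
Qed.

Lemma orbit_detached_cycle U i :
    (forall j, (phi j \in U) = (j \in U)) -> {in U &, injective phi} ->
    i \in U -> phi i != i ->
  [set j in orbit phi i] \in detached_cycles phi.
Proof.
move=> closedU injU Ui ni.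
have orbU j : j \in orbit phi i -> j \in U.
  rewrite -fconnect_orbit => /iter_findex <-; elim: findex => //= m.
  by rewrite closedU.
have cyc : fcycle phi (orbit phi i).
  apply/(orbitPcycle 0 5) => j k /orbU Uj /orbU Uk; exact: injU.
rewrite inE; apply/and3P; split.
- apply/existsP; exists i; apply/existsP.
  have lt_order : order phi i < n.+1.
    by rewrite ltnS -[X in _ <= X]card_ord max_card.
  exists (Ordinal lt_order); rewrite /= order_gt0 orbit_uniq eqxx !andbT.
  by apply/eqP/(orbitPcycle 0 4).
- apply/forallP => j; apply/implyP; rewrite !inE; apply: contra => oj.
  have oj' := oj; rewrite -fconnect_orbit in oj'.
  have Uj : j \in U by rewrite -closedU orbU.
  (* The predecessor [k] of [phi j] on the orbit has the same image as [j], so injectivity on [U]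
     puts [j] on the orbit. *)
  have [k ok kj] : exists2 k, k \in orbit phi i & phi k = phi j.
    exists (prev (orbit phi i) (phi j)); first by rewrite mem_prev.
    by apply/eqP; apply: (prev_cycle cyc).
  by rewrite -(injU _ _ (orbU _ ok) Uj kj).
rewrite cardsE; apply/card_gt1P; exists i, (phi i); split.
- by rewrite -fconnect_orbit connect0.
- by rewrite -fconnect_orbit fconnect1.
by rewrite eq_sym.
Qed.

Lemma detached_cycles_eq C C' i : C \in detached_cycles phi ->
  C' \in detached_cycles phi -> i \in C -> i \in C' -> C = C'.
Proof.
move=> /detached_cyclesP[_ _ _ _ CE] /detached_cyclesP[_ _ _ _ C'E] Ci C'i.
by rewrite (CE _ Ci) -C'E.
Qed.

End DetachedCycles.

(** Take the sum over [Q] after identifying [A] with the cyclic group on ['I_a.+1]; all terms but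
    that of [m] cancel. *)
Lemma exists_checksum (A : finType) n (Q : {set 'I_n}) : 0 < #|A| ->
  exists h : state A n -> A, forall m (x y : state A n), m \in Q ->
    {in Q, forall q, q != m -> x q = y q} -> h x = h y -> x m = y m.
Proof.
case cA : #|A| => [//|a] _.
pose e u : 'I_a.+1 := cast_ord cA (enum_rank u).
pose d u : A := enum_val (cast_ord (esym cA) u).
exists (fun x => d (\sum_(q in Q) e (x q))%R) => m x y Qm xy.
move=> /enum_val_inj/cast_ord_inj.
rewrite (bigD1 m) // [RHS](bigD1 m) //=.
rewrite (eq_bigr (fun q => e (y q))); last by move=> q /andP[Qq qm]; rewrite xy.
by move=> /GRing.addIr/cast_ord_inj/enum_rank_inj.
Qed.

(** * Programs as paths between encodings of the input *)

Section Programs.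
Variables (A : finType) (n : nat).
Implicit Types (E : transformation A n) (x y : state A n) (i j : 'I_n).

(** [E] and [E'] give the contents as functions of the initial state, so the program need only be
    right on states of the form [E x]. *)
Definition leads_to E E' L :=
  exists p, [/\ all (@instruction A n) p, size p = L
    & forall x, run p (E x) = E' x].

Lemma leads_to_refl E E' : E =1 E' -> leads_to E E' 0.
Proof. by move=> EE'; exists [::]. Qed.

Lemma leads_to_trans E1 E2 E3 a b :
  leads_to E1 E2 a -> leads_to E2 E3 b -> leads_to E1 E3 (a + b).
Proof.
move=> [p [ip <- pE]] [q [iq <- qE]]; exists (p ++ q).
by rewrite all_cat ip iq size_cat; split=> // x; rewrite run_cat pE.
Qed.

Lemma leads_to_pre E E1 E2 a :
  leads_to E1 E2 a -> leads_to (E1 \o E) (E2 \o E) a.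
Proof. by case=> p [ip sp pE]; exists p; split=> // x; rewrite /= pE. Qed.

Lemma leads_to_eq E1 E1' E2 E2' a : E1 =1 E1' -> E2 =1 E2' ->
  leads_to E1 E2 a -> leads_to E1' E2' a.
Proof.
by move=> e1 e2 [p [ip sp pE]]; exists p; split=> // x; rewrite -e1 -e2.
Qed.

(* One instruction suffices as soon as the new value is a function of the
   current contents; since states are finite, that function is found by
   search. *)
Lemma leads_to_step E E' i :
    (forall x j, j != i -> E' x j = E x j) ->
    (forall x y, E x = E y -> E' x i = E' y i) ->
  leads_to E E' 1.
Proof.
move=> E'E detE'.
(* States outside the range of [E] are never met; leaving them unchanged keeps [g] an
   instruction. *)
pose g y := if [pick x | E x == y] is Some x
  then [ffun j => if j == i then E' x i else y j] else y.
exists [:: g]; split=> //=.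
  rewrite andbT; apply: (@leq_trans #|[set i]|); last by rewrite cards1.
  apply/subset_leq_card/subsetP => j; rewrite !inE; apply: contraR => ji.
  apply/forallP => y; rewrite /g; case: pickP => // x _.
  by rewrite ffunE (negPf ji).
move=> x; rewrite /run /= /g; case: pickP => [y /eqP Eyx|/(_ x)/eqP//].
apply/ffunP => j; rewrite ffunE; have [->|ji] := eqVneq; first exact: detE'.
by rewrite E'E.
Qed.

End Programs.

(** * Upper bound: programs for the manipulation of variables *)

Section Manipulations.
Variables (A : finType) (n : nat) (phi : 'I_n -> 'I_n).
Implicit Types (S Q C K : {set 'I_n}) (i j : 'I_n).

(** [S] collects the coordinates already holding their final value: [set0] gives the identity and
    [setT] the whole manipulation. *)
Definition partial_manipulation S : transformation A n :=
  fun x => [ffun i => x (if i \in S then phi i else i)].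

Local Notation part := partial_manipulation.

Lemma leads_to_comp S C L : {in C, forall i, phi i \in C} -> [disjoint C & S] ->
  leads_to (part set0) (part C) L -> leads_to (part S) (part (C :|: S)) L.
Proof.
move=> closedC dCS /(leads_to_pre (part S)); apply: leads_to_eq => x.
  by apply/ffunP => i; rewrite !ffunE !inE.
apply/ffunP => i; rewrite !ffunE !inE; case: (boolP (i \in C)) => [Ci|_] //=.
by rewrite (disjointFr dCS) ?closedC.
Qed.

(* While the pivot r holds a checksum of the original values on Q, the value
   of any one element of Q that no longer occurs in the state is still
   determined by it. *)
Lemma leads_to_rotation Q r : 0 < #|A| ->
    (forall i, i \in Q -> phi i \in Q) ->
    (forall i, i \in Q -> exists2 j, j \in Q & phi j = i) ->
    (r \in Q -> forall K, r \in K -> {in K, forall i, phi i \in K} ->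
       Q \subset K) ->
    (r \notin Q -> phi r \notin r |: Q) ->
  leads_to (part set0) (part (r |: Q)) (#|r |: Q|.+1).
Proof.
move=> A0 closedQ surjQ cycQ leafr; have [h hP] := exists_checksum Q A0.
(* A pivot in [Q] is the case of a single cycle; a pivot outside [Q] is meant for a leaf. The pivot
   stores the checksum, [S] final values, and the rest original ones. *)
pose held S : transformation A n :=
  fun x => [ffun i => if i == r then h x else x (if i \in S then phi i else i)].
(* All values on Q except possibly that of m survive overwriting r and S. *)
pose recoverable S := exists m, {in Q, forall q, q != m ->
  q \in r |: S -> exists2 s, s \in S & phi s = q}.
have held_off S x y q : q \notin r |: S -> held S x = held S y -> x q = y q.
  rewrite !inE negb_or => /andP[/negPf qr /negPf qS] /ffunP/(_ q).
  by rewrite !ffunE qr qS.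
(* The values on [Q] other than that of [m] are read off in place or from a copy in [S]; the
   checksum then yields that of [m]. *)
have held_on S x y q : recoverable S -> r \notin S -> q \in Q ->
    held S x = held S y -> x q = y q.
  move=> [m mP] rS Qq exy.
  have off q' : q' \in Q -> q' != m -> x q' = y q'.
    move=> Qq' q'm; have [rSq'|nrSq'] := boolP (q' \in r |: S).
      have [s Ss <-] := mP _ Qq' q'm rSq'.
      have sr : s != r by apply: contraNneq rS => <-.
      by move/ffunP: exy => /(_ s); rewrite !ffunE (negPf sr) Ss.
    exact: held_off exy.
  have [qm|] := eqVneq q m; last exact: off.
  apply: hP Qq _ _; first by move=> q' Qq' q'q; apply: off; rewrite // -qm.
  by move/ffunP: exy => /(_ r); rewrite !ffunE eqxx.
have fill k S : #|(Q :\ r) :\: S| = k -> S \subset Q :\ r -> recoverable S ->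
    leads_to (held S) (held (Q :\ r)) k /\ recoverable (Q :\ r).
  elim: k S => [|k IH] S.
    move=> /eqP; rewrite cards_eq0 setD_eq0 => QS SQ recS.
    have <- : S = Q :\ r by apply/eqP; rewrite eqEsubset SQ.
    by split=> //; apply: leads_to_refl.
  move=> card SQ recS.
  have rS : r \notin S by apply/negP => /(subsetP SQ); rewrite !inE eqxx.
  (* If no value is lost, any [i] may be overwritten next, only its own value being at risk. If that
     of [m] is lost, a preimage [i] of [m] is overwritten, which restores it. *)
  have [i [Qi nSi recSi]] : exists i, [/\ i \in Q :\ r, i \notin S &
      recoverable (i |: S)].
    pose lost q := [&& q \in Q, q \in r |: S & ~~ [exists s in S, phi s == q]].
    have keep (q i : 'I_n) : q \in r |: (i |: S) -> q != i -> q \in r |: S.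
      by rewrite !inE => /or3P[->//|->//|->]; rewrite orbT.
    have found (q : 'I_n) : q \in Q -> ~~ lost q -> q \in r |: S ->
        exists2 s, s \in S & phi s = q.
      rewrite /lost => -> /= /nandP[/negPf->//|/negPn/exists_inP[s Ss /eqP e] _].
      by exists s.
    have [m lm|nlost] := pickP lost; last first.
      have /card_gt0P[i] : 0 < #|(Q :\ r) :\: S| by rewrite card.
      rewrite inE => /andP[nSi Qi]; exists i; split=> //; exists i.
      move=> q Qq qi /keep/(_ qi)/(found _ Qq).
      by rewrite nlost => -[]// s Ss <-; exists s; rewrite // inE Ss orbT.
    have uniq_lost (q : 'I_n) : q \in Q -> q != m -> q \in r |: S ->
        exists2 s, s \in S & phi s = q.
      move=> Qq qm Kq; apply: found => //.
      case/and3P: lm => Qm Km /exists_inP nm.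
      apply/negP => /and3P[_ _ /exists_inP nq].
      case: recS => m' m'P.
      have [mm'|mm'] := eqVneq m m'; last first.
        by have [s Ss e] := m'P _ Qm mm' Km; case: nm; exists s; rewrite ?e.
      have [|s Ss e] := m'P q Qq _ Kq; first by rewrite -mm'.
      by case: nq; exists s; rewrite ?e.
    case/and3P: (lm) => Qm Km nm; have [i Qi im] := surjQ _ Qm.
    have nSi : i \notin S.
      by apply: contra nm => Si; apply/exists_inP; exists i; rewrite ?im.
    (* If [r] were the preimage of [m], then [r |: S] would be contained in its own image, hence
       stable under [phi]. It would contain all of [Q], leaving nothing to fill. *)
    have ir : i != r.
      apply/eqP => eir; rewrite eir in im Qi.
      have SQ' : S \subset Q by apply: subset_trans SQ (subD1set _ _).
      have KQ : r |: S \subset Q by rewrite subUset sub1set Qi.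
      have KphiK : r |: S \subset phi @: (r |: S).
        apply/subsetP => q Kq; have [->|qm] := eqVneq q m.
          by rewrite -im imset_f // setU11.
        have [s Ss <-] := uniq_lost _ (subsetP KQ _ Kq) qm Kq.
        by rewrite imset_f // inE Ss orbT.
      have phiK : phi @: (r |: S) = r |: S.
        by apply/esym/eqP; rewrite eqEcard KphiK leq_imset_card.
      have : Q \subset r |: S.
        apply: cycQ; rewrite ?setU11 // => s Ks.
        by rewrite -[in X in _ \in X]phiK imset_f.
      rewrite -(setD1K Qi) => /subsetP sub.
      have : (Q :\ r) :\: S == set0.
        apply/eqP/setP => q; rewrite !inE; apply/negbTE/negP.
        move=> /and3P[nSq qr Qq]; have := sub q; rewrite !inE (negPf qr) Qq.
        by move=> /(_ isT); rewrite (negPf nSq).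
      by rewrite -cards_eq0 card.
    exists i; split; rewrite ?inE ?ir //; exists i => q Qq qi /keep/(_ qi) Kq.
    have [->|qm] := eqVneq q m; first by exists i; rewrite ?setU11.
    by have [s Ss <-] := uniq_lost _ Qq qm Kq; exists s; rewrite // inE Ss orbT.
  have [] := IH (i |: S) _ _ recSi.
  - apply/eqP; rewrite -eqSS -card (cardsD1 i ((Q :\ r) :\: S)) inE nSi Qi.
    rewrite add1n eqSS; apply/eqP/eq_card => q.
    by rewrite !inE negb_or -andbA.
  - by rewrite subUset sub1set Qi.
  move=> toQ recQ; split=> //; rewrite -add1n; apply: leads_to_trans toQ.
  have ir : i != r by move: Qi; rewrite !inE => /andP[].
  apply: (leads_to_step (i := i)) => [x j ji|x y exy].
    by rewrite !ffunE !inE (negPf ji).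
  rewrite !ffunE (negPf ir) setU11.
  apply: held_on exy => //; apply: closedQ; by move: Qi; rewrite !inE => /andP[].
have rec0 : recoverable set0.
  by exists r => q _ qr; rewrite !inE (negPf qr).
have [|toQ recQ] := fill _ set0 erefl _ rec0; first exact: sub0set.
(* One instruction stores the checksum, one fills each coordinate of [Q] other than [r], and the
   last completes the pivot. *)
have -> : #|r |: Q|.+1 = 1 + #|(Q :\ r) :\: set0| + 1.
  by rewrite setD0 add1n addn1 cardsU1 (cardsD1 r Q); case: (r \in Q).
apply: leads_to_trans; first apply: leads_to_trans toQ.
  apply: (leads_to_step (i := r)) => [x j jr|x y exy].
    by rewrite !ffunE (negPf jr).
  have -> // : x = y; apply/ffunP => j.
  by move/ffunP: exy => /(_ j); rewrite !ffunE inE.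
apply: (leads_to_step (i := r)) => [x j jr|x y exy].
  by rewrite !ffunE !inE (negPf jr).
(* If [r] is in [Q], the value of [phi r] is recovered by [held_on]; otherwise it is still in
   place. *)
rewrite !ffunE setU11; have [Qr|nQr] := boolP (r \in Q).
  by apply: held_on exy; rewrite ?closedQ // !inE eqxx.
apply: held_off exy; apply: contra (leafr nQr).
by rewrite !inE => /orP[->//|/andP[_ ->]]; rewrite orbT.
Qed.

(* Overwriting only leaves and elements with a preimage in S keeps a copy of
   every value still needed; if no such element is left, phi permutes ~: S,
   which thus consists of fixed points and detached cycles. *)
Lemma leads_to_grow S :
    (forall i, phi i \in S -> exists2 j, j \in S & phi j = phi i) ->
    fixed_points phi \subset S ->
    (forall C, C \in detached_cycles phi -> C \subset S) ->
  leads_to (part S) (part setT) #|~: S|.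
Proof.
have [k] := ubnP #|~: S|; elim: k S => // k IH S.
rewrite ltnS => leSk keepS FS DS.
have [/eqP|nS0] := eqVneq #|~: S| 0.
  rewrite cards_eq0 -subset0 -setCT setCS subTset => /eqP->.
  by rewrite setCT cards0; apply: leads_to_refl.
pose ready i := (i \notin S) && ((i \in phi @: S) || (i \notin phi @: setT)).
have [i /andP[nSi readyi]|stuck] := pickP ready; last first.
  have closedS i : i \in S -> phi i \in S.
    move=> Si; apply: contraFT (stuck (phi i)) => nSp.
    by rewrite /ready nSp imset_f.
  have surjU : ~: S \subset phi @: ~: S.
    apply/subsetP => i; rewrite inE => nSi.
    have := stuck i; rewrite /ready nSi => /norP[_ /negPn/imsetP[j _ ij]].
    rewrite ij imset_f // inE; apply: contra nSi => /closedS.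
    by rewrite -ij.
  have cardU : #|phi @: ~: S| == #|~: S|.
    by rewrite eqn_leq leq_imset_card subset_leq_card.
  have imU : phi @: (~: S) = ~: S.
    by apply/esym/eqP; rewrite eqEcard surjU leq_imset_card.
  have closedU i : (phi i \in ~: S) = (i \in ~: S).
    apply/idP/idP => [|Ui]; last by rewrite -imU imset_f.
    by rewrite !inE; apply/contra/closedS.
  have /card_gt0P[i Ui] : 0 < #|~: S| by rewrite lt0n.
  have ni : phi i != i.
    apply: contraTneq Ui => fi; rewrite inE negbK.
    by apply: (subsetP FS); rewrite inE fi.
  have := DS _ (orbit_detached_cycle closedU (imset_injP cardU) Ui ni).
  move=> /subsetP/(_ i); rewrite inE in_orbit => /(_ isT) Si.
  by rewrite inE Si in Ui.
have cardE : #|~: S| = 1 + #|~: (i |: S)|.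
  by rewrite (cardsD1 i (~: S)) inE nSi setCU setDE setIC.
rewrite cardE; apply: leads_to_trans (IH _ _ _ _ _).
- apply: (leads_to_step (i := i)) => [x j ji|x y exy].
    by rewrite !ffunE !inE (negPf ji).
  rewrite !ffunE setU11; have [Sp|nSp] := boolP (phi i \in S).
    have [j Sj <-] := keepS _ Sp.
    by move/ffunP: exy => /(_ j); rewrite !ffunE Sj.
  by move/ffunP: exy => /(_ (phi i)); rewrite !ffunE (negPf nSp).
- by apply: leq_trans leSk; rewrite cardE.
(* The value of [i] has a copy at some [l] in [S], or is read nowhere when [i] is a leaf. *)
- move=> j; rewrite inE => /orP[/set1P pji|/keepS[l Sl <-]]; last first.
    by exists l; rewrite // inE Sl orbT.
  case/orP: readyi => [/imsetP[l Sl il]|/negP[]].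
    by exists l; rewrite -?il // inE Sl orbT.
  by rewrite -pji imset_f.
- exact: subset_trans FS (subsetUr _ _).
by move=> C /DS CS; apply: subset_trans CS (subsetUr _ _).
Qed.

(** Fixed points hold their final value from the start, and by [leads_to_grow] every other
    coordinate outside [S] costs one instruction: the excess [L] is paid on [S] alone. *)
Lemma program_of_prefix S L :
    leads_to (part set0) (part S) (#|S| + L) ->
    [disjoint S & fixed_points phi] ->
    (forall i, phi i \in S -> exists2 j, j \in S & phi j = phi i) ->
    (forall C, C \in detached_cycles phi -> C \subset S) ->
  exists2 p, computes p (@manipulation A n phi)
    & size p = n - #|fixed_points phi| + L.
Proof.
move=> toS dSF keepS DS; pose SF := S :|: fixed_points phi.
have toSF : leads_to (part set0) (part SF) (#|S| + L).
  apply: leads_to_eq toS => // x; apply/ffunP => i; rewrite !ffunE !inE.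
  by case: (i \in S) => //=; case: eqP => [->|].
have [||C /DS CS|p [ip sp pE]] := leads_to_trans toSF (@leads_to_grow SF _ _ _).
- move=> i; rewrite inE => /orP[/keepS[j Sj <-]|Fp].
    by exists j; rewrite // inE Sj.
  by exists (phi i); [rewrite inE Fp orbT|move: Fp; rewrite inE => /eqP].
- exact: subsetUr.
- exact: subset_trans CS (subsetUl _ _).
exists p.
  split=> // x; have := pE x; congr (run p _ = _); apply/ffunP => i.
    by rewrite ffunE inE.
  by rewrite !ffunE inE.
rewrite sp addnAC; congr (_ + _).
have := cardsC SF; rewrite cardsU (disjoint_setI0 dSF) cards0 subn0 card_ord.
by rewrite addnAC => /(congr1 (subn^~ #|fixed_points phi|)) <-; rewrite addnK.
Qed.

Let detached_points := \bigcup_(C in detached_cycles phi) C.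

Lemma detached_pointsP i : reflect
  (exists2 C, C \in detached_cycles phi & i \in C) (i \in detached_points).
Proof. exact: bigcupP. Qed.

Lemma detached_points_closed i :
  (phi i \in detached_points) = (i \in detached_points).
Proof.
by apply/detached_pointsP/detached_pointsP => -[C DC Ci]; exists C => //; move: Ci;
  have [_ _ ->] := detached_cyclesP DC.
Qed.

Lemma cycle_surj C i : C \in detached_cycles phi -> i \in C ->
  exists2 j, j \in C & phi j = i.
Proof.
case/detached_cyclesP => _ _ closedC injC _ Ci.
have /eqP imC : phi @: C == C.
  rewrite eqEcard (card_in_imset injC) leqnn andbT.
  by apply/subsetP => _ /imsetP[j Cj ->]; rewrite closedC.
by move: Ci; rewrite -{1}imC => /imsetP[j Cj ->]; exists j.
Qed.

Lemma detached_points_surj i : i \in detached_points ->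
  exists2 j, j \in detached_points & phi j = i.
Proof.
move=> /detached_pointsP[C DC Ci]; have [j Cj ji] := cycle_surj DC Ci.
by exists j => //; apply/detached_pointsP; exists C.
Qed.

Lemma leads_to_cycle C : 0 < #|A| -> C \in detached_cycles phi ->
  leads_to (part set0) (part C) #|C|.+1.
Proof.
move=> A0 DC; have [/set0Pn[r Cr] _ closedC _ CE] := detached_cyclesP DC.
have rC : r |: C = C by apply/setUidPr; rewrite sub1set.
rewrite -rC; apply: leads_to_rotation => //.
- by move=> i Ci; rewrite closedC.
- by move=> i; apply: cycle_surj.
- move=> _ K Kr closedK; rewrite (CE r Cr); apply/subsetP => j.
  rewrite inE -fconnect_orbit => /iter_findex <-.
  by elim: findex => //= m; apply: closedK.
by rewrite Cr.
Qed.

(** Detached cycles are disjoint and closed, so they can be rotated one after another, each with one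
    extra instruction. *)
Lemma leads_to_cycles s : 0 < #|A| -> uniq s ->
    {subset s <= detached_cycles phi} ->
  leads_to (part set0) (part (\bigcup_(C <- s) C))
    (#|\bigcup_(C <- s) C| + size s).
Proof.
move=> A0; elim: s => [_ _|C s IH /= /andP[nsC us] sD].
  by rewrite big_nil cards0; apply: leads_to_refl.
have DC : C \in detached_cycles phi by rewrite sD ?mem_head.
have sD' : {subset s <= detached_cycles phi}.
  by move=> C' sC'; rewrite sD // inE sC' orbT.
have dCs : [disjoint C & \bigcup_(C' <- s) C'].
  rewrite disjoint_subset; apply/subsetP => i Ci; rewrite inE.
  rewrite bigcup_seq; apply: contra nsC => /bigcupP[C' sC' C'i].
  by rewrite (detached_cycles_eq DC (sD' _ sC') Ci C'i).
have [_ _ closedC _ _] := detached_cyclesP DC.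
rewrite big_cons cardsU (disjoint_setI0 dCs) cards0 subn0.
have -> m k l : m + k + l.+1 = k + l + m.+1 by rewrite !addnS -addnA addnC.
apply: leads_to_trans (leads_to_comp _ dCs _); first exact: IH.
  by move=> i Ci; rewrite closedC.
exact: leads_to_cycle.
Qed.

Lemma detached_points_fixed : [disjoint detached_points & fixed_points phi].
Proof.
rewrite disjoint_subset; apply/subsetP => i /detached_pointsP[C DC Ci].
by rewrite !inE; have [_ ->] := detached_cyclesP DC.
Qed.

Lemma detached_sub C : C \in detached_cycles phi -> C \subset detached_points.
Proof. exact: bigcup_sup. Qed.

Lemma program_cycles : 0 < #|A| ->
  exists2 p, computes p (@manipulation A n phi)
    & size p = n - #|fixed_points phi| + #|detached_cycles phi|.
Proof.
move=> A0; apply: (@program_of_prefix detached_points).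
- have := @leads_to_cycles (enum (detached_cycles phi)) A0 (enum_uniq _).
  rewrite big_enum -cardE; apply=> C; by rewrite mem_enum.
- exact: detached_points_fixed.
- by move=> i Di; apply: detached_points_surj.
exact: detached_sub.
Qed.

(** No coordinate reads the leaf [r], so it can hold one checksum for all detached cycles. Its own
    source [phi r] lies outside [r] and these cycles, and survives their rotation. *)
Lemma program_leaf r : 0 < #|A| -> r \notin phi @: setT ->
  exists2 p, computes p (@manipulation A n phi)
    & size p = n - #|fixed_points phi| + 1.
Proof.
move=> A0 leafr.
have npr i : phi i != r by apply: contraNneq leafr => <-; rewrite imset_f.
have nDr : r \notin detached_points.
  by apply/negP => /detached_points_surj[j _ /eqP]; apply/negP.
apply: (@program_of_prefix (r |: detached_points)).
- rewrite addn1; apply: leads_to_rotation => //.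
  + by move=> i; rewrite detached_points_closed.
  + exact: detached_points_surj.
  + by rewrite (negPf nDr).
  by rewrite !inE negb_or npr detached_points_closed.
- by rewrite disjoints_subset subUset sub1set !inE npr
    -disjoints_subset detached_points_fixed.
- move=> i; rewrite !inE (negPf (npr i)) /= => /detached_points_surj[j Dj <-].
  by exists j; rewrite // inE Dj orbT.
by move=> C /detached_sub CD; apply: subset_trans CD (subsetUr _ _).
Qed.

End Manipulations.

Theorem theorem4 (A : finType) (n : nat) (phi : 'I_n -> 'I_n) (F D : nat)
  (hA : 2 <= #|A|) (hn : 2 <= n)
  (hF : #|fixed_points phi| = F) (hD : #|detached_cycles phi| = D) :
  [/\ bijective phi ->
        procedural_complexity_is (@manipulation A n phi) (n - F + D),
      ~ bijective phi -> 0 < D ->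
        procedural_complexity_is (@manipulation A n phi) (n - F + 1)
    & ~ bijective phi -> D = 0 ->
        procedural_complexity_is (@manipulation A n phi) (n - F)].
Proof.
have A0 : 0 < #|A| by apply: ltnW.
rewrite -{}hF -{}hD; split=> [bphi|nbphi D0|_ D0].
- split=> [|p cp]; first exact: program_cycles.
  apply: leq_trans (size_program_ge hA cp); rewrite leq_add2l.
  have meet C : C \in detached_cycles phi ->
      exists i, (i \in C) && (1 < updates p i).
    move=> /detached_cyclesP[/set0Pn[i0 Ci0] nC closedC _ _].
    have [|i Ci ui] := bijective_updates hA bphi cp Ci0.
      by move=> i Ci; rewrite nC // closedC.
    by exists i; rewrite Ci.
  (* Some detached cycle must exist to supply the default [i0] of [rep], which is never taken on a
     detached cycle. *)
  have [->|/set0Pn[C0 DC0]] := eqVneq (detached_cycles phi) set0.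
    by rewrite cards0.
  have [i0 _] := meet _ DC0.
  pose rep (C : {set 'I_n}) := odflt i0 [pick i in C | 1 < updates p i].
  have repP C : C \in detached_cycles phi ->
      rep C \in C /\ 1 < updates p (rep C).
    move=> /meet[i mi]; rewrite /rep; case: pickP => [j /andP[]//|/(_ i)].
    by rewrite mi.
  have inj_rep : {in detached_cycles phi &, injective rep}.
    move=> C C' DC DC' repE; apply: (detached_cycles_eq DC DC').
      exact: (repP _ DC).1.
    by rewrite repE; exact: (repP _ DC').1.
  rewrite -(card_in_imset inj_rep) subset_leq_card //.
  apply/subsetP => _ /imsetP[C DC ->]; rewrite inE; exact: (repP _ DC).2.
- split=> [|p cp].
    (* On a finite set a surjective [phi] would be bijective, so some [r] has no preimage. *)
    have [sub|/subsetPn[r _]] := boolP (setT \subset phi @: setT); last first.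
      exact: program_leaf.
    case: nbphi; apply: injF_bij; have inj : {in setT &, injective phi}.
      by apply/imset_injP; rewrite eqn_leq leq_imset_card subset_leq_card.
    by move=> i j; apply: inj; rewrite inE.
  apply: leq_trans (size_program_ge hA cp); rewrite leq_add2l.
  have /card_gt0P[C DC] := D0.
  have [/set0Pn[i0 Ci0] nC closedC _ _] := detached_cyclesP DC.
  have [i Ci|i ui] := detached_updates hA cp Ci0 _ closedC.
    by have [j _ ji] := cycle_surj DC Ci; split; [apply: nC|exists j].
  by apply/card_gt0P; exists i; rewrite inE.
split=> [|p cp]; last first.
  by apply: leq_trans (size_program_ge hA cp); apply: leq_addr.
by have := @program_cycles A n phi A0; rewrite D0 addn0.
Qed.
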